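(* Let $0<\alpha<2/L$ and $\mathbf{y}_0\in\mathbb{R}^{np}$. There exists a constant $B_y>0$, independent of $k$ and $t$, such that the NEAR-DGD$^t$ iterates with steplength $\alpha$ started from $\mathbf{y}_0$ satisfy $\|\mathbf{y}_{k+1}\|\le B_y$ for all $k\ge0$ and all $t\in\mathbb{N}^+$, and such that the following holds for every $t\in\mathbb{N}^+$. Suppose that $\mathbf{y}_k\to\mathbf{y}^\infty$, let $\mathbf{x}^\infty=\mathbf{Z}^t\mathbf{y}^\infty=[(x_1^\infty)',\dots,(x_n^\infty)']'$, and let $\bar{x}^\infty=\bar{y}^\infty=\frac1n\sum_{i=1}^n x_i^\infty$. Then $\bar{x}^\infty$ is an approximate critical point of $f$: $$\|\nabla f(\bar{x}^\infty)\|\le \beta^t\sqrt{n}\,L\,B_y .$$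
   Context: Setting. Let $n\ge 2$, $p\ge 1$, and let $\mathcal{G}=(\mathcal{V},\mathcal{E})$ be a connected undirected graph with $\mathcal{V}=\{1,\dots,n\}$. Let $f_i:\mathbb{R}^p\to\mathbb{R}$, $i=1,\dots,n$, be differentiable (possibly nonconvex), and $f(x)=\sum_{i=1}^n f_i(x)$ for $x\in\mathbb{R}^p$. For $\mathbf{x}=[x_1',\dots,x_n']'\in\mathbb{R}^{np}$ with $x_i\in\mathbb{R}^p$, put $\mathbf{f}(\mathbf{x})=\sum_{i=1}^n f_i(x_i)$. For $\mathbf{v}=[v_1',\dots,v_n']'\in\mathbb{R}^{np}$ write $\bar v=\frac1n\sum_i v_i$. Standing assumptions. (1) $\mathbf{W}\in\mathbb{R}^{n\times n}$ is symmetric, doubly stochastic, positive definite, and $w_{ij}>0$ if $(i,j)\in\mathcal{E}$ or $i=j$, and $w_{ij}=0$ otherwise; $\beta$ denotes the second largest eigenvalue of $\mathbf{W}$. (2) $\nabla\mathbf{f}$ is Lipschitz with constant $L>0$: $\|\nabla\mathbf{f}(\mathbf{x})-\nabla\mathbf{f}(\mathbf{y})\|\le L\|\mathbf{x}-\mathbf{y}\|$ for all $\mathbf{x},\mathbf{y}\in\mathbb{R}^{np}$. (3) $\mathbf{f}$ is coercive: $\mathbf{f}(\mathbf{x}_k)\to\infty$ whenever $\|\mathbf{x}_k\|\to\infty$. (4) For every $t\in\mathbb{N}^+$ the Lyapunov function $\mathcal{L}_t$ below is a KL function. Method. Let $\mathbf{Z}=\mathbf{W}\otimes I_p$, so $\mathbf{Z}^t=\mathbf{W}^t\otimes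 I_p$. For $t\in\mathbb{N}^+$, $\alpha>0$ and arbitrary $\mathbf{y}_0\in\mathbb{R}^{np}$, the NEAR-DGD$^t$ iterates are, for $k\ge 0$, $\mathbf{x}_k=\mathbf{Z}^t\mathbf{y}_k$ and $\mathbf{y}_{k+1}=\mathbf{x}_k-\alpha\nabla\mathbf{f}(\mathbf{x}_k)$. Lyapunov function. $\mathcal{L}_t(\mathbf{y})=\mathbf{f}(\mathbf{Z}^t\mathbf{y})+\frac{1}{2\alpha}\langle\mathbf{y},\mathbf{Z}^t\mathbf{y}\rangle-\frac{1}{2\alpha}\langle\mathbf{y},\mathbf{Z}^{2t}\mathbf{y}\rangle$. KL property (for a continuously differentiable $h:\mathbb{R}^N\to\mathbb{R}$). $h$ has the KL property at $x^\star$ if there exist $\eta\in(0,+\infty]$, a neighborhood $U$ of $x^\star$, and a continuous concave function $\phi:[0,\eta)\to[0,\infty)$ such that $\phi(0)=0$, $\phi$ is $C^1$ on $(0,\eta)$, $\phi'(s)>0$ for all $s\in(0,\eta)$, and for all $x\in U$ with $h(x^\star)<h(x)<h(x^\star)+\eta$ the KL inequality $\phi'(h(x)-h(x^\star))\,\|\nabla h(x)\|\ge 1$ holds. $h$ is a KL function if it has the KL property at every point. *)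

(* Defs.v *)
From HB Require Import structures.
From mathcomp Require Import all_boot all_order all_algebra.
From mathcomp Require Import all_classical all_reals all_analysis.
From mathcomp Require Import mxtens.

Set Implicit Arguments.
Unset Strict Implicit.
Unset Printing Implicit Defensive.
Import Order.TTheory GRing.Theory Num.Theory.
Import numFieldNormedType.Exports.
Local Open Scope classical_set_scope.
Local Open Scope ring_scope.

(* The library norm `|v| on 'cV[R]_N is the sup norm; [norm2] is the Euclidean
   one. The two induce the same topology, so the library's convergence and
   differentiability on 'cV[R]_N are the usual ones. *)
Definition dot (R : realType) (N : nat) (u v : 'cV[R]_N) : R :=
  \sum_(i < N) u i 0 * v i 0.

Definition norm2 (R : realType) (N : nat) (v : 'cV[R]_N) : R :=
  Num.sqrt (dot v v).

(* Meaningful where h is differentiable (partial derivatives are total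
   functions in the library). *)
Definition grad (R : realType) (N : nat) (h : 'cV[R]_N -> R) (x : 'cV[R]_N)
    : 'cV[R]_N :=
  \col_(i < N) 'D_(delta_mx i 0) h x.

Definition coercive (R : realType) (N : nat) (h : 'cV[R]_N -> R) : Prop :=
  forall x : nat -> 'cV[R]_N,
    norm2 (x k) @[k --> \oo] --> +oo -> h (x k) @[k --> \oo] --> +oo.

Definition KL_at (R : realType) (N : nat) (h : 'cV[R]_N -> R) (xs : 'cV[R]_N)
    : Prop :=
  exists (eta : \bar R) (U : set 'cV[R]_N) (phi : R -> R),
  let I := [set s : R | 0 <= s /\ (s%:E < eta)%E] in
  let dphi : R -> R := phi^`()%classic in
  [/\ (0 < eta)%E, nbhs xs U,
      [/\ {within I, continuous phi},
          @convex_function R R^o I (fun s => - phi s),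
          (forall s, I s -> 0 <= phi s)
        & phi 0 = 0],
      (forall s, 0 < s -> (s%:E < eta)%E ->
         [/\ derivable phi s 1, {for s, continuous dphi} & 0 < dphi s])
    & forall x, U x -> h xs < h x -> ((h x)%:E < (h xs)%:E + eta)%E ->
        1 <= dphi (h x - h xs) * norm2 (grad h x)].

Definition KL_function (R : realType) (N : nat) (h : 'cV[R]_N -> R) : Prop :=
  forall x, KL_at h x.

Definition positive_definite (R : realType) (n : nat) (W : 'M[R]_n) : Prop :=
  forall v : 'cV[R]_n, v != 0 -> 0 < dot v (W *m v).

Definition doubly_stochastic (R : realType) (n : nat) (W : 'M[R]_n) : Prop :=
  [/\ forall i j, 0 <= W i j,
      forall i, \sum_j W i j = 1
    & forall j, \sum_i W i j = 1].

(* Eigenvalues are listed with multiplicity in nonincreasing order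
   s`_0 >= s`_1 >= ... *)
Definition second_largest_eigenvalue (R : realType) (n : nat) (W : 'M[R]_n)
    (beta : R) : Prop :=
  exists s : seq R,
    [/\ char_poly W = \prod_(a <- s) ('X - a%:P),
        sorted >=%R s, (1 < size s)%N & beta = s`_1].

(* A vector of R^(np) is a column vector of height n * p whose entry
   mxtens_index (i, j), i.e. i * p + j, is the j-th coordinate of its i-th
   block. This is the indexing used by the Kronecker product [tensmx]. *)
Definition blk (R : realType) (n p : nat) (x : 'cV[R]_(n * p)) (i : 'I_n)
    : 'cV[R]_p :=
  \col_(j < p) x (mxtens_index (i, j)) 0.

Definition block_mean (R : realType) (n p : nat) (x : 'cV[R]_(n * p))
    : 'cV[R]_p :=
  n%:R^-1 *: \sum_(i < n) blk x i.

Definition sum_obj (R : realType) (n p : nat) (f : 'I_n -> 'cV[R]_p -> R)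
    (x : 'cV[R]_p) : R :=
  \sum_(i < n) f i x.

Definition stacked_obj (R : realType) (n p : nat) (f : 'I_n -> 'cV[R]_p -> R)
    (x : 'cV[R]_(n * p)) : R :=
  \sum_(i < n) f i (blk x i).

Definition kronI (R : realType) (n : nat) (p : nat) (W : 'M[R]_n)
    : 'M[R]_(n * p) :=
  tensmx W (1%:M : 'M[R]_p).

Definition Lyapunov (R : realType) (n p : nat) (f : 'I_n -> 'cV[R]_p -> R)
    (W : 'M[R]_n) (alpha : R) (t : nat) (y : 'cV[R]_(n * p)) : R :=
  let Z := kronI p W in
  stacked_obj f (Z ^+ t *m y)
  + (2 * alpha)^-1 * dot y (Z ^+ t *m y)
  - (2 * alpha)^-1 * dot y (Z ^+ (2 * t) *m y).

Fixpoint neardgd_y (R : realType) (n p : nat) (f : 'I_n -> 'cV[R]_p -> R)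
    (W : 'M[R]_n) (alpha : R) (t : nat) (y0 : 'cV[R]_(n * p)) (k : nat)
    : 'cV[R]_(n * p) :=
  if k is k'.+1 then
    let x := kronI p W ^+ t *m neardgd_y f W alpha t y0 k' in
    x - alpha *: grad (stacked_obj f) x
  else y0.

(* Main.v *)
(** With S = Z^t one has 0 <= S <= I, hence <d, S d> >= |S d|^2, and for
    alpha < 2 / L the Lyapunov function decreases along the iterates.  It
    dominates f(x_k), and its initial value is bounded uniformly in t, so
    coercivity bounds x_k, hence y_(k+1), uniformly in k and t.

    A limit satisfies y = S y - alpha grad f(S y).  As W preserves block means,
    the block gradients at x = S y sum to zero, so grad f(xbar) is the sum over
    the blocks of the difference between the gradients at the consensus vector
    1 (x) xbar and at x, of norm at most sqrt n * L * |x - 1 (x) xbar|.  The last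
    factor is at most beta^t |y|: with J the averaging matrix,
    W^t - J = (W - J)^t and 0 <= W - J <= beta.  Indeed a maximizer of the
    Rayleigh quotient of W - J is an eigenvector; when its eigenvalue is
    positive it is orthogonal to the constants, so it is an eigenvector of W
    whose eigenvalue is < 1 because the graph is connected. *)

Require Import Defs.
From HB Require Import structures.
From mathcomp Require Import all_boot all_order all_algebra.
From mathcomp Require Import all_classical all_reals all_analysis.
From mathcomp Require Import mxtens.
From mathcomp Require Import ring lra.

Set Implicit Arguments.
Unset Strict Implicit.
Unset Printing Implicit Defensive.
Import Order.TTheory GRing.Theory Num.Theory.
Import numFieldNormedType.Exports.
Local Open Scope classical_set_scope.
Local Open Scope ring_scope.

(** * Euclidean inner product and norm *)

Section DotProduct.
Context {R : realType} {N : nat}.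
Implicit Types (u v w : 'cV[R]_N) (A : 'M[R]_N) (c : R).

Lemma dotC u v : dot u v = dot v u.
Proof. by apply: eq_bigr => i _; rewrite mulrC. Qed.

Lemma dotDl u v w : dot (u + v) w = dot u w + dot v w.
Proof. by rewrite -big_split; apply: eq_bigr => i _; rewrite mxE mulrDl. Qed.

Lemma dotZl c u w : dot (c *: u) w = c * dot u w.
Proof. by rewrite mulr_sumr; apply: eq_bigr => i _; rewrite mxE mulrA. Qed.

Lemma dotDr w u v : dot w (u + v) = dot w u + dot w v.
Proof. by rewrite ![dot w _]dotC dotDl. Qed.

Lemma dotZr c w u : dot w (c *: u) = c * dot w u.
Proof. by rewrite ![dot w _]dotC dotZl. Qed.

Lemma dotNl u w : dot (- u) w = - dot u w.
Proof. by rewrite -scaleN1r dotZl mulN1r. Qed.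

Lemma dotNr w u : dot w (- u) = - dot w u.
Proof. by rewrite ![dot w _]dotC dotNl. Qed.

Definition dotE := (dotDl, dotDr, dotNl, dotNr, dotZl, dotZr).

Lemma dot0l u : dot 0 u = 0.
Proof. by rewrite -(scale0r u) dotZl mul0r. Qed.

Lemma dot_ge0 v : 0 <= dot v v.
Proof. by apply: sumr_ge0 => i _; rewrite -expr2 sqr_ge0. Qed.

Lemma dot_eq0 v : (dot v v == 0) = (v == 0).
Proof.
apply/eqP/eqP => [v0|->]; last by rewrite dot0l.
apply/matrixP => i j; rewrite ord1 mxE; apply/eqP.
rewrite -sqrf_eq0 expr2.
by move/psumr_eq0P: v0 => ->// k _; rewrite -expr2 sqr_ge0.
Qed.

Lemma dot_mulmx u A v : dot u (A *m v) = dot (A^T *m u) v.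
Proof.
transitivity (\sum_i \sum_j u i 0 * A i j * v j 0).
  apply: eq_bigr => i _; rewrite mxE mulr_sumr.
  by apply: eq_bigr => j _; rewrite mulrA.
rewrite exchange_big; apply: eq_bigr => j _; rewrite mxE mulr_suml.
by apply: eq_bigr => i _; rewrite mxE (mulrC (u i 0)).
Qed.

Lemma norm2_ge0 v : 0 <= norm2 v.
Proof. exact: sqrtr_ge0. Qed.

Lemma norm2_sqr v : norm2 v ^+ 2 = dot v v.
Proof. by rewrite sqr_sqrtr ?dot_ge0. Qed.

Lemma norm2_le v c : 0 <= c -> (norm2 v <= c) = (dot v v <= c ^+ 2).
Proof. by move=> c0; rewrite -norm2_sqr ler_sqr ?nnegrE ?norm2_ge0. Qed.

Lemma norm2N v : norm2 (- v) = norm2 v.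
Proof. by rewrite /norm2 dotNl dotNr opprK. Qed.

Lemma norm2Z c v : 0 <= c -> norm2 (c *: v) = c * norm2 v.
Proof.
by move=> c0; rewrite /norm2 dotZl dotZr mulrA -expr2 sqrtrM ?sqr_ge0//
  sqrtr_sqr ger0_norm.
Qed.

Lemma norm2_eq0 v : (norm2 v == 0) = (v == 0).
Proof. by rewrite -dot_eq0 -norm2_sqr sqrf_eq0. Qed.

(** Cauchy-Schwarz: expand the square of [norm2 v *: u - norm2 u *: v] and divide by the product of
    the norms, zero vectors being treated apart. *)
Lemma dot_le_norm2 u v : dot u v <= norm2 u * norm2 v.
Proof.
have [/eqP|u0] := eqVneq (norm2 u) 0.
  by rewrite norm2_eq0 => /eqP ->; rewrite dot0l mulr_ge0 ?norm2_ge0.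
have [/eqP|v0] := eqVneq (norm2 v) 0.
  by rewrite norm2_eq0 => /eqP ->; rewrite dotC dot0l mulr_ge0 ?norm2_ge0.
have ugt0 : 0 < norm2 u by rewrite lt_def u0 norm2_ge0.
have vgt0 : 0 < norm2 v by rewrite lt_def v0 norm2_ge0.
have := dot_ge0 (norm2 v *: u - norm2 u *: v).
rewrite !dotE (dotC v u) -!norm2_sqr => h.
rewrite -(ler_pM2l (mulr_gt0 ugt0 vgt0)).
nra.
Qed.

Lemma norm2D u v : norm2 (u + v) <= norm2 u + norm2 v.
Proof.
rewrite norm2_le ?addr_ge0 ?norm2_ge0// !dotE (dotC v u) -!norm2_sqr.
by have := dot_le_norm2 u v; nra.
Qed.

Lemma norm2B u v : norm2 (u - v) <= norm2 u + norm2 v.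
Proof. by rewrite -(norm2N v) norm2D. Qed.

Lemma norm2_sum (I : finType) (F : I -> 'cV[R]_N) :
  norm2 (\sum_i F i) <= \sum_i norm2 (F i).
Proof.
elim/big_ind2: _ => [|a x b y ax bxy|//]; first by rewrite /norm2 dot0l sqrtr0.
by rewrite (le_trans (norm2D _ _))// lerD.
Qed.

(** Transfers convergence in the sup norm to the Euclidean norm; the crude constant [N] avoids a
    square root. *)
Lemma norm2_le_mx_norm v : norm2 v <= N%:R * `|v|.
Proof.
rewrite norm2_le ?mulr_ge0//.
have entry i : `|v i 0| <= `|v|.
  rewrite [leRHS]/Num.norm /= mx_normrE.
  exact: (le_bigmax _ (fun ij => `|v ij.1 ij.2|) (i, 0)).
apply: (@le_trans _ _ (\sum_(i < N) `|v| ^+ 2)).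
  apply: ler_sum => i _; rewrite -expr2 -(real_normK (num_real _)).
  by rewrite ler_sqr ?nnegrE.
rewrite exprMn sumr_const card_ord -[leLHS]mulr_natl ler_wpM2r ?sqr_ge0//.
by rewrite -natrX ler_nat; case: (N) => // m; rewrite leq_pmull.
Qed.

End DotProduct.

(** * Symmetric positive semidefinite matrices *)

Section QuadraticForms.
Context {R : realType} {N : nat}.
Implicit Types (u v w : 'cV[R]_N) (A : 'M[R]_N) (c : R).

Lemma dot_symmx A u v : A^T = A -> dot u (A *m v) = dot (A *m u) v.
Proof. by move=> Asym; rewrite dot_mulmx Asym. Qed.

(* With [0 <= A <= c], the form [c (c A - A^2)] is nonnegative because it is
   the sum [A (c - A) A + (c - A) A (c - A)]. *)
Lemma dot_mulmx_le A c u : A^T = A -> 0 < c ->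
    (forall v, 0 <= dot v (A *m v)) ->
    (forall v, dot v (A *m v) <= c * dot v v) ->
  dot (A *m u) (A *m u) <= c * dot u (A *m u).
Proof.
move=> Asym c0 A0 Ac.
have h1 := Ac (A *m u); have h2 := A0 (c *: u - A *m u).
rewrite -(ler_pM2l c0).
move: h2; rewrite mulmxBr -scalemxAr !dotE (dot_symmx u (A *m u) Asym) => h2.
by nra.
Qed.

Lemma norm2_mulmx_le A c u : A^T = A -> 0 < c ->
    (forall v, 0 <= dot v (A *m v)) ->
    (forall v, dot v (A *m v) <= c * dot v v) ->
  norm2 (A *m u) <= c * norm2 u.
Proof.
move=> Asym c0 A0 Ac.
rewrite norm2_le ?mulr_ge0 ?(ltW c0) ?norm2_ge0// exprMn norm2_sqr.
rewrite (le_trans (dot_mulmx_le u Asym c0 A0 Ac))// expr2 -mulrA.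
by rewrite ler_wpM2l ?(ltW c0).
Qed.

Lemma exp_mulmxS A t u : A ^+ t.+1 *m u = A *m (A ^+ t *m u).
Proof. by rewrite exprS mulmxA. Qed.

Lemma exp_mulmxSr A t u : A ^+ t.+1 *m u = A ^+ t *m (A *m u).
Proof. by rewrite exprSr mulmxA. Qed.

Lemma trmx_exp A t : A^T = A -> (A ^+ t)^T = A ^+ t.
Proof.
move=> Asym; elim: t => [|t IH]; first exact: trmx1.
by rewrite {1}exprS trmx_mul IH Asym exprSr.
Qed.

Lemma norm2_exp_mulmx_le A c t u : 0 <= c ->
    (forall v, norm2 (A *m v) <= c * norm2 v) ->
  norm2 (A ^+ t *m u) <= c ^+ t * norm2 u.
Proof.
move=> c0 Ac; elim: t => [|t IH]; first by rewrite !expr0 mul1r mul1mx.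
by rewrite exp_mulmxS (le_trans (Ac _))// exprS -mulrA ler_wpM2l.
Qed.

(** By symmetry one factor [A] moves to each side of the form, lowering the exponent by two; hence
    the two base cases 0 and 1. *)
Lemma dot_exp_mulmx_ge0 A t u : A^T = A ->
  (forall v, 0 <= dot v (A *m v)) -> 0 <= dot u (A ^+ t *m u).
Proof.
move=> Asym A0; elim/ltn_ind: t u => -[|[|t]] IH u.
- by rewrite expr0 mul1mx dot_ge0.
- by rewrite expr1.
- by rewrite exp_mulmxS exp_mulmxSr dot_symmx// IH.
Qed.

(** With [w = A v], the form at [v - s w] equals [s^2 b - 2 s |w|^2], which is negative for small
    positive [s] unless [w = 0]. *)
Lemma psd_kernel A v : A^T = A -> (forall w, 0 <= dot w (A *m w)) ->
  dot v (A *m v) = 0 -> A *m v = 0.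
Proof.
move=> Asym A0 v0; apply/eqP; rewrite -dot_eq0 eq_le dot_ge0 andbT.
set w := A *m v; set b := dot w (A *m w).
have b0 : 0 <= b by exact: A0.
have h (s : R) : 0 <= s ^+ 2 * b - 2 * s * dot w w.
  have := A0 (v - s *: w).
  rewrite mulmxBr -scalemxAr !dotE v0 -/b (dot_symmx v w Asym) -/w.
  by move=> hs; nra.
rewrite leNgt; apply/negP => w0.
have b1 : 0 < b + 1 by lra.
(* The shift by 1 keeps the denominator positive when [b = 0]; for this [s] the form is
   [- s^2 (b + 2)], which is negative. *)
have := h (dot w w / (b + 1)); set s := dot w w / (b + 1).
have s0 : 0 < s by rewrite divr_gt0.
have -> : dot w w = s * (b + 1) by rewrite divfK// gt_eqF.
by nra.
Qed.

Lemma continuous_dot_mulmx A :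
  continuous (fun v : 'rV[R]_N => dot v^T (A *m v^T)).
Proof.
have -> : (fun v : 'rV[R]_N => dot v^T (A *m v^T)) =
    (fun v : 'rV[R]_N => \sum_i (v 0 i * \sum_j (A i j * v 0 j))).
  apply/funext => w; apply: eq_bigr => i _; rewrite !mxE.
  by congr (_ * _); apply: eq_bigr => j _; rewrite mxE.
have addC : continuous (fun x : R * R => x.1 + x.2) by exact: add_continuous.
have row i : continuous (fun v : 'rV[R]_N => \sum_j (A i j * v 0 j)).
  apply: (continuous_big (F := fun j (v : 'rV[R]_N) => A i j * v 0 j) addC).
  move=> j _ v; apply: continuousM; first exact: cst_continuous.
  exact: coord_continuous.
apply: (continuous_big
  (F := fun i (v : 'rV[R]_N) => v 0 i * \sum_j (A i j * v 0 j)) addC).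
move=> i _ v; apply: continuousM; first exact: coord_continuous.
exact: row.
Qed.

End QuadraticForms.

(** * Top eigenvector of a symmetric matrix, by compactness of the sphere *)

Lemma closed_rV_sphere (R : realType) N :
  closed [set v : 'rV[R]_N | dot v^T v^T = 1].
Proof.
have -> : [set v : 'rV[R]_N | dot v^T v^T = 1] =
    (fun v : 'rV[R]_N => dot v^T (1%:M *m v^T)) @^-1` [set 1].
  by apply/seteqP; split=> v /=; rewrite mul1mx.
apply: closed_comp => [v _|]; first exact: continuous_dot_mulmx.
exact: closed_eq.
Qed.

Lemma compact_rV_sphere (R : realType) N :
  compact [set v : 'rV[R]_N | dot v^T v^T = 1].
Proof.
apply: bounded_closed_compact; last exact: closed_rV_sphere.
exists 1; split; first exact: num_real.
move=> M M1 v /= v1; apply: le_trans (ltW M1).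
rewrite [leLHS]/Num.norm /= mx_normrE; apply: bigmax_le => // -[i j] _ /=.
rewrite ord1 -(@ler_pXn2r _ 2)// ?nnegrE// expr1n -v1 (real_normK (num_real _)).
rewrite /dot (bigD1 j)//= !mxE -expr2 lerDl sumr_ge0// => k _.
by rewrite -expr2 sqr_ge0.
Qed.

(* The eigenvector is a maximizer of the Rayleigh quotient. *)
Lemma symmx_max_eigenvector (R : realType) N (A : 'M[R]_N.+1) : A^T = A ->
  exists lam (v : 'cV[R]_N.+1), [/\ v != 0, A *m v = lam *: v &
    forall u, dot u (A *m u) <= lam * dot u u].
Proof.
move=> Asym.
have S0 : [set v : 'rV[R]_N.+1 | dot v^T v^T = 1] !=set0.
  exists (delta_mx 0 0); rewrite /= /dot (bigD1 0)//= !mxE !eqxx mulr1 big1 ?addr0//.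
  by move=> i /negbTE i0; rewrite !mxE i0 andbF mulr0.
have [] := EVT_max_rV S0 (@compact_rV_sphere R N.+1)
  (f := fun v => dot v^T (A *m v^T)).
  exact/continuous_subspaceT/continuous_dot_mulmx.
move=> w; rewrite inE /= => w1 wmax; set lam := dot w^T (A *m w^T) in wmax.
have Alam u : dot u (A *m u) <= lam * dot u u.
  have [->|u0] := eqVneq u 0; first by rewrite !dot0l mulr0.
  have nu0 : norm2 u != 0 by rewrite norm2_eq0.
  have := wmax ((norm2 u)^-1 *: u^T).
  rewrite inE /= linearZ /= trmxK -scalemxAr !dotE -norm2_sqr.
  have -> : (norm2 u)^-1 * ((norm2 u)^-1 * norm2 u ^+ 2) = 1 by field.
  move=> /(_ erefl).
  rewrite mulrA -invfM -expr2 ler_pdivrMl 1?mulrC//.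
  by rewrite exprn_gt0// lt_def nu0 norm2_ge0.
exists lam, w^T; split=> //.
  by rewrite -dot_eq0 w1 oner_eq0.
(* By maximality [lam - A] is positive semidefinite, and its form vanishes at the maximizer, which
   therefore lies in its kernel. *)
apply/eqP; rewrite eq_sym -subr_eq0 -mul_scalar_mx -mulmxBl; apply/eqP.
apply: psd_kernel => [|u|].
- by rewrite linearB /= tr_scalar_mx Asym.
- by rewrite mulmxBl mul_scalar_mx !dotE subr_ge0.
- by rewrite mulmxBl mul_scalar_mx !dotE w1 mulr1 subrr.
Qed.

(** * Doubly stochastic matrices and deflation by averaging *)

Section DoublyStochastic.
Context {R : realType} {n : nat} (W : 'M[R]_n).
Hypotheses (Wsym : W^T = W) (Wds : doubly_stochastic W).
Implicit Types (u v : 'cV[R]_n).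

Let Wge0 i j : 0 <= W i j. Proof. by case: Wds. Qed.
Let Wrow i : \sum_j W i j = 1. Proof. by case: Wds. Qed.
Let Wcol j : \sum_i W i j = 1. Proof. by case: Wds. Qed.

(** Expanding the squares, row sums and column sums each contribute one [dot v v]. The sum of
    squares shows that [W <= 1] and controls the case of equality. *)
Lemma dirichlet_form v :
  \sum_i \sum_j W i j * (v i 0 - v j 0) ^+ 2 = 2 * (dot v v - dot v (W *m v)).
Proof.
have -> : \sum_i \sum_j W i j * (v i 0 - v j 0) ^+ 2 =
    \sum_i \sum_j W i j * v i 0 ^+ 2 + \sum_i \sum_j W i j * v j 0 ^+ 2
    - 2 * \sum_i \sum_j v i 0 * (W i j * v j 0).
  rewrite mulr_sumr -big_split -sumrB; apply: eq_bigr => i _ /=.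
  rewrite mulr_sumr -big_split -sumrB; apply: eq_bigr => j _ /=.
  by ring.
have -> : \sum_i \sum_j W i j * v i 0 ^+ 2 = dot v v.
  by apply: eq_bigr => i _; rewrite -mulr_suml Wrow mul1r expr2.
have -> : \sum_i \sum_j W i j * v j 0 ^+ 2 = dot v v.
  rewrite exchange_big; apply: eq_bigr => j _ /=.
  by rewrite -mulr_suml Wcol mul1r expr2.
have -> : \sum_i \sum_j v i 0 * (W i j * v j 0) = dot v (W *m v).
  by apply: eq_bigr => i _; rewrite mxE mulr_sumr.
by ring.
Qed.

Lemma ds_dot_mulmx_le v : dot v (W *m v) <= dot v v.
Proof.
rewrite -subr_ge0 -(pmulr_rge0 _ (ltr0Sn R 1)) -dirichlet_form.
by apply: sumr_ge0 => i _; apply: sumr_ge0 => j _; rewrite mulr_ge0 ?sqr_ge0.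
Qed.

(** The Dirichlet form of a fixed vector is zero, so each of its nonnegative terms is; positive
    weights force equal values across every edge, and paths propagate this. *)
Lemma ds_fixpoint_constant (E : rel 'I_n) v :
    (forall i j, connect E i j) -> (forall i j, E i j -> 0 < W i j) ->
  W *m v = v -> forall i j, v i 0 = v j 0.
Proof.
move=> Econn Wpos vfix.
have := dirichlet_form v; rewrite vfix subrr mulr0 => d0.
have edge i j : E i j -> v i 0 = v j 0.
  move=> Eij; apply/eqP; rewrite -subr_eq0 -sqrf_eq0.
  have di0 : \sum_j W i j * (v i 0 - v j 0) ^+ 2 = 0.
    move/psumr_eq0P: d0; apply => // k _.
    by apply: sumr_ge0 => l _; rewrite mulr_ge0 ?sqr_ge0.
  have /eqP : W i j * (v i 0 - v j 0) ^+ 2 = 0.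
    by move/psumr_eq0P: di0; apply => // l _; rewrite mulr_ge0 ?sqr_ge0.
  by rewrite mulf_eq0 gt_eqF ?Wpos.
move=> i j; have /connectP[q] := Econn i j.
elim: q i => [|k q IH] i /=; first by move=> _ ->.
by case/andP=> /edge -> /IH.
Qed.

Lemma ds_sum_mulmx v : \sum_i (W *m v) i 0 = \sum_i v i 0.
Proof.
under eq_bigr do rewrite mxE.
rewrite exchange_big; apply: eq_bigr => j _ /=.
by rewrite -mulr_suml Wcol mul1r.
Qed.

Lemma ds_sum_exp_mulmx t v : \sum_i (W ^+ t *m v) i 0 = \sum_i v i 0.
Proof.
elim: t => [|t IH]; first by rewrite expr0 mul1mx.
by rewrite exp_mulmxS ds_sum_mulmx.
Qed.

Definition mean v : R := n%:R^-1 * \sum_i v i 0.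
(** For [n > 0], the orthogonal projection J onto the constant vectors. *)
Definition avgmx : 'M[R]_n := const_mx n%:R^-1.

Lemma avgmx_mul v : avgmx *m v = const_mx (mean v).
Proof.
apply/matrixP => i j; rewrite !mxE /mean mulr_sumr ord1.
by apply: eq_bigr => k _; rewrite mxE.
Qed.

Lemma mulmx_const (c : R) : W *m const_mx c = const_mx c :> 'cV_n.
Proof.
apply/matrixP => i j; rewrite !mxE; under eq_bigr do rewrite mxE.
by rewrite -mulr_suml Wrow mul1r.
Qed.

Lemma dot_const_l (c : R) v : dot (const_mx c) v = c * \sum_i v i 0.
Proof. by rewrite mulr_sumr; apply: eq_bigr => i _; rewrite mxE. Qed.

Hypothesis n_gt0 : (0 < n)%N.

Lemma mean_const (c : R) : mean (const_mx c) = c.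
Proof.
rewrite /mean; under eq_bigr do rewrite mxE.
by rewrite sumr_const card_ord -[c *+ n]mulr_natl mulKf// pnatr_eq0 -lt0n.
Qed.

Lemma sum_mean v : \sum_i v i 0 = n%:R * mean v.
Proof. by rewrite mulVKf// pnatr_eq0 -lt0n. Qed.

Lemma mean_exp_mulmx t v : mean (W ^+ t *m v) = mean v.
Proof. by rewrite /mean ds_sum_exp_mulmx. Qed.

(** The cross terms collapse because W J = J W = J and J J = J. At [t = 0] the left side would be
    [v] itself, whence [0 < t]. *)
Lemma deflated_exp_mulmx t v : (0 < t)%N ->
  (W - avgmx) ^+ t *m v = W ^+ t *m v - const_mx (mean v).
Proof.
case: t => // t _.
elim: t => [|t IH]; first by rewrite !expr1 mulmxBl avgmx_mul.
rewrite exp_mulmxS IH mulmxBl !mulmxBr mulmx_const !avgmx_mul mean_const.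
by rewrite mean_exp_mulmx subrr subr0 [in RHS]exp_mulmxS.
Qed.

Lemma trmx_deflated : (W - avgmx)^T = W - avgmx.
Proof. by rewrite linearB /= Wsym trmx_const. Qed.

(** Subtracting the mean from [v] gives [w] with (W - J) v = W w. As [W *m w] has zero sum, it is
    orthogonal to constants, so the form is that of [W] at [w]. *)
Lemma deflated_ge0 v : positive_definite W -> 0 <= dot v ((W - avgmx) *m v).
Proof.
move=> Wpd; set w := v - const_mx (mean v).
have Vv : (W - avgmx) *m v = W *m w.
  by rewrite mulmxBl mulmxBr mulmx_const avgmx_mul.
have sumw : \sum_i w i 0 = 0.
  under eq_bigr do rewrite !mxE.
  by rewrite sumrB sum_mean sumr_const card_ord -[mean v *+ n]mulr_natl subrr.
have -> : dot v ((W - avgmx) *m v) = dot w (W *m w).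
  by rewrite Vv [in RHS]/w dotDl dotNl dot_const_l ds_sum_mulmx sumw mulr0 subr0.
have [->|w0] := eqVneq w 0; first by rewrite dot0l.
by rewrite ltW// Wpd.
Qed.

End DoublyStochastic.

(** * Eigenvalues of the mixing matrix and the spectral gap *)

Lemma symmx_eigenvalueP (R : realType) n (W : 'M[R]_n) (s : seq R) a :
    W^T = W -> char_poly W = \prod_(b <- s) ('X - b%:P) ->
  a \in s <-> exists2 v : 'cV[R]_n, v != 0 & W *m v = a *: v.
Proof.
move=> Wsym charW; rewrite -root_prod_XsubC -charW -eigenvalue_root_char.
split=> [/eigenvalueP[v vW v0]|[v v0 vW]].
  exists v^T; first by rewrite trmx_eq0.
  by rewrite -[W]Wsym -trmx_mul vW linearZ.
apply/eigenvalueP; exists v^T; last by rewrite trmx_eq0.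
by rewrite -[W]Wsym -trmx_mul vW linearZ.
Qed.

Section SpectralGap.
Context {R : realType} {n : nat} (W : 'M[R]_n.+1) (E : rel 'I_n.+1) (beta : R).
Hypotheses (Wsym : W^T = W) (Wds : doubly_stochastic W)
  (Wpd : positive_definite W) (Econn : forall i j, connect E i j)
  (Wpos : forall i j, E i j -> 0 < W i j)
  (hbeta : second_largest_eigenvalue W beta).

Lemma second_eigenvalue_gt0 : 0 < beta.
Proof.
case: hbeta => s [charW _ size_s ->].
have /(symmx_eigenvalueP _ Wsym charW)[v v0 vW] := mem_nth 0 size_s.
have := Wpd v0; rewrite vW dotZr pmulr_lgt0//.
by rewrite lt_def dot_eq0 v0 dot_ge0.
Qed.

Lemma deflated_dot_mulmx_le (u : 'cV[R]_n.+1) :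
  dot u ((W - avgmx) *m u) <= beta * dot u u.
Proof.
have [lam [v [v0 Vv lamP]]] := symmx_max_eigenvector (trmx_deflated Wsym).
apply: le_trans (lamP u) _; rewrite ler_wpM2r ?dot_ge0//.
have [lam0|lam0] := leP lam 0; first by rewrite (le_trans lam0)// ltW// second_eigenvalue_gt0.
(* W - J maps every vector to one of zero sum, so [lam] times the sum of [v] vanishes, with
   [lam > 0]. *)
have meanv : mean v = 0.
  have : \sum_i ((W - avgmx) *m v) i 0 = 0.
    transitivity (\sum_i ((W *m v) i 0 - mean v)).
      by apply: eq_bigr => i _; rewrite mulmxBl avgmx_mul !mxE.
    rewrite sumrB (ds_sum_mulmx Wds) sum_mean// sumr_const card_ord.
    by rewrite -[mean v *+ _]mulr_natl subrr.
  rewrite Vv; under eq_bigr do rewrite mxE.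
  rewrite -mulr_sumr => /eqP; rewrite mulf_eq0 gt_eqF//= => /eqP sumv.
  by rewrite /mean sumv mulr0.
have Wv : W *m v = lam *: v.
  rewrite -Vv mulmxBl avgmx_mul meanv.
  by apply/matrixP => i j; rewrite !mxE subr0.
have vv0 : 0 < dot v v by rewrite lt_def dot_eq0 v0 dot_ge0.
have lam_le1 : lam <= 1.
  by rewrite -(ler_pM2r vv0) mul1r -dotZr -Wv ds_dot_mulmx_le.
have lam_neq1 : lam != 1.
  apply: contra_neq v0 => lam1; rewrite lam1 scale1r in Wv.
  have vconst := ds_fixpoint_constant Wds Econn Wpos Wv.
  have vE : v = const_mx (v 0 0).
    by apply/matrixP => i j; rewrite mxE ord1; exact: vconst.
  by move: meanv; rewrite vE mean_const// => ->; apply/matrixP => i j; rewrite !mxE.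
case: hbeta => s [charW sorted_s size_s ->].
have sorted_nth i j : (i <= j)%N -> (j < size s)%N -> s`_j <= s`_i.
  move=> ij js; apply: (sorted_leq_nth ge_trans ge_refl 0 sorted_s) => //.
  exact: leq_ltn_trans js.
have /(nthP 0)[k ks s_k] : 1 \in s.
  apply/(symmx_eigenvalueP _ Wsym charW); exists (const_mx 1).
    by apply/eqP => /matrixP/(_ 0 0)/eqP; rewrite !mxE oner_eq0.
  by rewrite scale1r mulmx_const.
have /(nthP 0)[[|l] ls s_l] : lam \in s.
- by apply/(symmx_eigenvalueP _ Wsym charW); exists v.
- have := sorted_nth 0%N k (leq0n _) ks.
  by rewrite s_k s_l leNgt lt_neqAle lam_neq1 lam_le1.
- by rewrite -s_l sorted_nth.
Qed.

Lemma norm2_exp_mulmx_sub_mean t (u : 'cV[R]_n.+1) : (0 < t)%N ->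
  norm2 (W ^+ t *m u - const_mx (mean u)) <= beta ^+ t * norm2 u.
Proof.
move=> t0; rewrite -deflated_exp_mulmx//.
have beta0 := second_eigenvalue_gt0.
apply: norm2_exp_mulmx_le => [|v]; first exact: ltW.
apply: norm2_mulmx_le => //.
- exact: trmx_deflated.
- by move=> w; exact: deflated_ge0.
- exact: deflated_dot_mulmx_le.
Qed.

End SpectralGap.

(** * Blocks and coordinate slices of stacked vectors *)

Section Blocks.
Context {R : realType} {n p : nat}.
Implicit Types (x y : 'cV[R]_(n * p)) (W : 'M[R]_n).

Lemma big_mxtens_index (F : 'I_(n * p) -> R) :
  \sum_k F k = \sum_i \sum_j F (mxtens_index (i, j)).
Proof.
rewrite pair_big; rewrite (reindex (@mxtens_index n p)) /=; last first.
  exists (@mxtens_unindex n p) => ? _; [exact: mxtens_indexK|exact: mxtens_unindexK].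
by apply: eq_bigr => -[].
Qed.

Lemma dot_blk x y : dot x y = \sum_i dot (blk x i) (blk y i).
Proof.
rewrite /dot big_mxtens_index; apply: eq_bigr => i _.
by apply: eq_bigr => j _; rewrite !mxE.
Qed.

Lemma blkD x y i : blk (x + y) i = blk x i + blk y i.
Proof. by apply/matrixP => j k; rewrite !mxE. Qed.

Lemma blkZ c x i : blk (c *: x) i = c *: blk x i.
Proof. by apply/matrixP => j k; rewrite !mxE. Qed.

Lemma blkB x y i : blk (x - y) i = blk x i - blk y i.
Proof. by apply/matrixP => j k; rewrite !mxE. Qed.

(* The j-th coordinates of the n blocks, on which [kronI p W] acts as W. *)
Definition coord_slice (j : 'I_p) x : 'cV[R]_n :=
  \col_i x (mxtens_index (i, j)) 0.

Lemma dot_slice x y : dot x y = \sum_j dot (coord_slice j x) (coord_slice j y).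
Proof.
rewrite /dot big_mxtens_index exchange_big; apply: eq_bigr => j _.
by apply: eq_bigr => i _; rewrite !mxE.
Qed.

Lemma coord_sliceB j x y : coord_slice j (x - y) = coord_slice j x - coord_slice j y.
Proof. by apply/matrixP => i k; rewrite !mxE. Qed.

Lemma slice_kronI W x j : coord_slice j (kronI p W *m x) = W *m coord_slice j x.
Proof.
apply/matrixP => i k; rewrite !mxE big_mxtens_index; apply: eq_bigr => l _.
rewrite (bigD1 j)//= big1 ?addr0 => [|m mj].
  by rewrite tensmxE !mxE eqxx mulr1.
by rewrite tensmxE !mxE eq_sym (negbTE mj) mulr0 mul0r.
Qed.

Lemma slice_exp_kronI W t x j :
  coord_slice j (kronI p W ^+ t *m x) = W ^+ t *m coord_slice j x.
Proof.
elim: t => [|t IH]; first by rewrite !expr0 !mul1mx.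
by rewrite !exp_mulmxS slice_kronI IH.
Qed.

Lemma trmx_kronI W : W^T = W -> (kronI p W)^T = kronI p W.
Proof. by move=> Wsym; rewrite /kronI trmx_tens Wsym trmx1. Qed.

Lemma block_mean_slice x j : block_mean x j 0 = mean (coord_slice j x).
Proof.
rewrite !mxE summxE /mean; congr (_ * _).
by apply: eq_bigr => i _; rewrite !mxE.
Qed.

(** The consensus vector 1 (x) c. *)
Definition stack (c : 'cV[R]_p) : 'cV[R]_(n * p) :=
  \col_k c (mxtens_unindex k).2 0.

Lemma blk_stack c i : blk (stack c) i = c.
Proof. by apply/matrixP => j k; rewrite !mxE mxtens_indexK ord1. Qed.

Lemma slice_stack c j : coord_slice j (stack c) = const_mx (c j 0).
Proof. by apply/matrixP => i k; rewrite !mxE mxtens_indexK. Qed.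

(** Triangle inequality, then Cauchy-Schwarz between the all-ones vector and the vector [u] of block
    norms. *)
Lemma norm2_sum_blk x : norm2 (\sum_i blk x i) <= Num.sqrt n%:R * norm2 x.
Proof.
pose u : 'cV[R]_n := \col_i norm2 (blk x i).
have -> : norm2 x = norm2 u.
  rewrite /norm2 dot_blk; congr Num.sqrt; apply: eq_bigr => i _.
  by rewrite mxE -expr2 norm2_sqr.
have -> : Num.sqrt n%:R = norm2 (const_mx 1 : 'cV[R]_n).
  rewrite /norm2 dot_const_l mul1r; congr Num.sqrt.
  by under eq_bigr do rewrite mxE; rewrite sumr_const card_ord.
apply: le_trans (dot_le_norm2 _ _); rewrite dot_const_l mul1r.
by apply: le_trans (norm2_sum _) _; apply: ler_sum => i _; rewrite mxE.
Qed.

End Blocks.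

(** * Gradients of the aggregate and stacked objectives *)

Section Gradient.
Context {R : realType}.

Lemma dot_grad N (h : 'cV[R]_N -> R) (x v : 'cV[R]_N) : differentiable h x ->
  'D_v h x = dot (grad h x) v.
Proof.
move=> dh; rewrite deriveE//.
have -> : v = \sum_i v i 0 *: delta_mx i 0.
  rewrite {1}(matrix_sum_delta v); apply: eq_bigr => i _.
  by rewrite big_ord1.
rewrite linear_sum /= [in RHS]/dot; apply: eq_bigr => i _.
rewrite linearZ /= mxE deriveE// mulrC; congr (_ * _).
rewrite summxE (bigD1 i)//= !mxE !eqxx mulr1 big1 ?addr0// => j ji.
by rewrite !mxE eq_sym (negbTE ji) mulr0.
Qed.

Lemma is_derive_line N (h : 'cV[R]_N -> R) (a b : 'cV[R]_N) (s : R) :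
    differentiable h (a + s *: b) ->
  is_derive s 1 (fun r : R => h (a + r *: b)) (dot (grad h (a + s *: b)) b).
Proof.
move=> dh; rewrite -(dot_grad _ dh).
have cv : derivable h (a + s *: b) b := diff_derivable dh.
have quot : (fun r : R => r^-1 *: (((fun r : R => h (a + r *: b)) \o shift s) (r *: 1)
      - h (a + s *: b))) =
    (fun r : R => r^-1 *: ((h \o shift (a + s *: b)) (r *: b) - h (a + s *: b))).
  apply/funext => r /=; congr (_ *: (h _ - _)).
  by rewrite [r *: 1]mulr1 scalerDl addrCA.
apply: DeriveDef; first by move: cv; rewrite /derivable quot.
by rewrite /derive quot.
Qed.

Context {n p : nat} (f : 'I_n -> 'cV[R]_p -> R).
Hypothesis fdiff : forall i x, differentiable (f i) x.

Lemma grad_sum_obj (x : 'cV[R]_p) : grad (sum_obj f) x = \sum_i grad (f i) x.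
Proof.
apply/matrixP => j k; rewrite mxE summxE.
have -> : sum_obj f = \sum_i f i by apply/funext => y; rewrite fct_sumE.
rewrite derive_sum => [|i]; last exact: diff_derivable.
by apply: eq_bigr => i _; rewrite mxE.
Qed.

Lemma blk_delta (i l : 'I_n) (j : 'I_p) :
  blk (delta_mx (mxtens_index (i, j)) 0 : 'cV[R]_(n * p)) l =
  (l == i)%:R *: delta_mx j 0.
Proof.
apply/matrixP => m k; rewrite !mxE !ord1 eqxx !andbT.
rewrite (inj_eq (can_inj (@mxtens_indexK n p))) xpair_eqE.
by case: (l == i); rewrite ?mul1r ?mul0r.
Qed.

(** Moving a coordinate of block [i] changes only the summand [f i], so the two difference quotients
    are the same function. *)
Lemma blk_grad_stacked_obj (x : 'cV[R]_(n * p)) i :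
  blk (grad (stacked_obj f) x) i = grad (f i) (blk x i).
Proof.
apply/matrixP => j k; rewrite !mxE /derive.
suff -> : (fun r : R => r^-1 *: ((stacked_obj f \o shift x)
      (r *: delta_mx (mxtens_index (i, j)) 0) - stacked_obj f x)) =
    (fun r : R => r^-1 *: ((f i \o shift (blk x i)) (r *: delta_mx j 0)
      - f i (blk x i))) by [].
apply/funext => r /=; congr (_ *: _).
rewrite /stacked_obj -sumrB (bigD1 i)//= big1 ?addr0 => [|l li].
  by rewrite blkD blkZ blk_delta eqxx scale1r.
by rewrite blkD blkZ blk_delta (negbTE li) scale0r scaler0 add0r subrr.
Qed.

(** Derivatives along lines are the only form in which smoothness enters the descent argument. *)
Lemma is_derive_stacked_obj_line (a b : 'cV[R]_(n * p)) (s : R) :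
  is_derive s 1 (fun r : R => stacked_obj f (a + r *: b))
    (dot (grad (stacked_obj f) (a + s *: b)) b).
Proof.
have -> : (fun r : R => stacked_obj f (a + r *: b)) =
    \sum_i (fun r : R => f i (blk a i + r *: blk b i)).
  apply/funext => r; rewrite fct_sumE; apply: eq_bigr => i _.
  by rewrite blkD blkZ.
rewrite dot_blk; apply: is_derive_sum => i.
by rewrite blk_grad_stacked_obj blkD blkZ; exact: is_derive_line.
Qed.

End Gradient.

(** * Descent inequality and decrease of the energy *)

Section GradientStep.
Context {R : realType} {N : nat}.
Variables (h : 'cV[R]_N -> R) (L : R).
Hypotheses (hline : forall (a b : 'cV[R]_N) (s : R),
    is_derive s 1 (fun r : R => h (a + r *: b)) (dot (grad h (a + s *: b)) b))
  (L_gt0 : 0 < L)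
  (gradLip : forall x y, norm2 (grad h x - grad h y) <= L * norm2 (x - y)).

Lemma descent (x d : 'cV[R]_N) :
  h (x + d) <= h x + dot (grad h x) d + L / 2 * dot d d.
Proof.
(* [g] is [h] along the segment minus its quadratic model without the constant term. By the mean
   value theorem it suffices that the derivative of [g] be nonpositive, which follows from
   Cauchy-Schwarz and the Lipschitz bound. *)
pose g (r : R) := h (x + r *: d) - (dot (grad h x) d * r + L / 2 * dot d d * r ^+ 2).
have dg (s : R) : is_derive s 1 g
    (dot (grad h (x + s *: d) - grad h x) d - L * s * dot d d).
  have hl := hline x d s.
  have -> : g = (fun r : R => h (x + r *: d))
      - (dot (grad h x) d \*: (id : R -> R) + (L / 2 * dot d d) \*: (id ^+ 2)).
    by apply/funext => r; rewrite /g !fctE.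
  apply: is_derive_eq; by rewrite !dotE /GRing.scale /=; field.
have := @MVT_segment R g _ 0 1 ler01 (fun s _ => dg s).
case=> [|c].
  apply: derivable_within_continuous => s _.
  by have [] := dg s.
rewrite in_itv /= => /andP[c0 c1].
rewrite /g scale1r scale0r addr0 !mulr0 expr0n mulr0 addr0 expr1n !subr0 !mulr1.
move=> gE; rewrite -subr_le0 opprD addrA.
suff : dot (grad h (x + c *: d) - grad h x) d <= L * c * dot d d by lra.
apply: le_trans (dot_le_norm2 _ _) _; rewrite -norm2_sqr expr2 mulrA.
rewrite ler_wpM2r ?norm2_ge0// (le_trans (gradLip _ _))//.
by rewrite [x + _]addrC addrK norm2Z// mulrA.
Qed.

Variables (alpha : R) (S : 'M[R]_N).
Hypotheses (alpha_gt0 : 0 < alpha) (alpha_lt : alpha < 2 / L)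
  (Ssym : S^T = S) (S_ge0 : forall v, 0 <= dot v (S *m v))
  (S_le1 : forall v, dot v (S *m v) <= dot v v).

(* For S = Z^t this is the Lyapunov function of the method. *)
Definition energy (y : 'cV[R]_N) : R :=
  h (S *m y) + (2 * alpha)^-1 * (dot y (S *m y) - dot (S *m y) (S *m y)).

Let S_sqr_le v : dot (S *m v) (S *m v) <= dot v (S *m v).
Proof.
rewrite -[leRHS]mul1r; apply: dot_mulmx_le => // w.
by rewrite mul1r.
Qed.

Lemma energy_ge (y : 'cV[R]_N) : h (S *m y) <= energy y.
Proof.
by rewrite lerDl mulr_ge0 ?subr_ge0 ?S_sqr_le// invr_ge0 mulr_ge0 ?ltW.
Qed.

(* The quadratic part of the energy turns the descent inequality between
   x = S y and x+ = S y+ into energy y+ - energy y <=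
   (L/2 - 1/(2 alpha)) |S d|^2 - 1/(2 alpha) <d, S d>, where d = y+ - y. *)
Lemma energy_step (y : 'cV[R]_N) :
  energy (S *m y - alpha *: grad h (S *m y)) <= energy y.
Proof.
set x := S *m y; set y' := x - _.
have [d y'E] : exists d, y' = y + d by exists (y' - y); rewrite addrC subrK.
have gE : grad h x = alpha^-1 *: (x - y').
  by rewrite /y' opprB addrCA subrr addr0 scalerA mulVf ?scale1r// gt_eqF.
have := descent x (S *m d).
rewrite /energy -/x gE [in S *m y']y'E mulmxDr -/x; set e := S *m d => desc.
have ee : dot e e <= dot d e by exact: S_sqr_le.
have ye : dot y e = dot d x.
  by rewrite /e /x dot_symmx// dotC.
clearbody x y' e.
have yy : dot y' (x + e) = dot y x + 2 * dot y e + dot d e.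
  by rewrite y'E !dotE ye; ring.
have e0 := dot_ge0 e.
(* With [a = (2 * alpha)^-1] the energy changes by at most [(L / 2 - a) |e|^2 - a <d, e>]. Since
   [|e|^2 <= <d, e>], this is at most [(L / 2 - 2 a) |e|^2], and the steplength condition gives
   [L / 2 <= 2 a]. *)
have La : L / 2 <= 2 * (2 * alpha)^-1.
  have : L * alpha < 2 by rewrite mulrC -ltr_pdivlMr.
  have -> : 2 * (2 * alpha)^-1 = alpha^-1 by field; rewrite ?gt_eqF.
  by rewrite -[leLHS](mulfK (lt0r_neq0 alpha_gt0)) ler_pdivrMr// mulVf ?gt_eqF//; lra.
have aE : alpha^-1 = 2 * (2 * alpha)^-1 by field; rewrite ?gt_eqF.
have a0 : 0 < (2 * alpha)^-1 by rewrite invr_gt0 mulr_gt0.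
rewrite {}yy; move: desc; rewrite y'E !dotE {}aE (dotC e x).
move: ((2 * alpha)^-1) La a0 => a La a0 desc.
nra.
Qed.

(** The right side is free of [S], so at [y0] it bounds the initial energy for all [t] at once. It
    comes from [descent] at 0 and [|S y| <= |y|]. *)
Lemma energy_le (y : 'cV[R]_N) : energy y <=
  h 0 + norm2 (grad h 0) * norm2 y + (L / 2 + (2 * alpha)^-1) * norm2 y ^+ 2.
Proof.
have Sy : norm2 (S *m y) <= norm2 y.
  by rewrite -[leRHS]mul1r norm2_mulmx_le// => v; rewrite mul1r.
have := descent 0 (S *m y); rewrite add0r => desc.
have gSy := dot_le_norm2 (grad h 0) (S *m y).
have ySy := S_le1 y; have S0 := dot_ge0 (S *m y).
have sqSy : dot (S *m y) (S *m y) <= norm2 y ^+ 2 by rewrite -norm2_le ?norm2_ge0.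
have a0 : 0 < (2 * alpha)^-1 by rewrite invr_gt0 mulr_gt0.
have h1 := ler_wpM2l (norm2_ge0 (grad h 0)) Sy.
have h2 : L / 2 * dot (S *m y) (S *m y) <= L / 2 * norm2 y ^+ 2.
  by rewrite ler_wpM2l// divr_ge0// ltW.
have h3 : (2 * alpha)^-1 * (dot y (S *m y) - dot (S *m y) (S *m y))
    <= (2 * alpha)^-1 * norm2 y ^+ 2.
  by rewrite ler_wpM2l ?(ltW a0)// norm2_sqr; lra.
rewrite /energy; lra.
Qed.

End GradientStep.

(** * Coercivity and limits of iterates *)

(** Otherwise one could choose points of the sublevel set with norm above every [k]; along them
    coercivity sends [h] to infinity. *)
Lemma coercive_sublevel_bounded (R : realType) N (h : 'cV[R]_N -> R) (M : R) :
  coercive h -> exists2 B, 0 <= B & forall x, h x <= M -> norm2 x <= B.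
Proof.
move=> hcoer; apply: contrapT => unbounded.
have /choice[x xP] : forall k : nat, exists x, h x <= M /\ k%:R < norm2 x.
  move=> k; apply: contrapT => kP; apply: unbounded; exists k%:R => // x hx.
  by rewrite leNgt; apply/negP => kx; apply: kP; exists x.
have : h (x k) @[k --> \oo] --> +oo.
  apply: hcoer; apply/cvgryPge => A.
  near=> k; apply: le_trans (ltW (proj2 (xP k))).
  near: k; exact: nbhs_infty_ger.
move=> /cvgryPgt/(_ M)[k _ /(_ k (leqnn k))].
by rewrite /= ltNge; case: (xP k) => ->.
Unshelve. all: by end_near. Qed.

Lemma norm2_cvg0 (R : realType) N (y : nat -> 'cV[R]_N) (l : 'cV[R]_N) (e : R) :
  y k @[k --> \oo] --> l -> 0 < e -> \forall k \near \oo, norm2 (y k - l) <= e.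
Proof.
move=> yl e0.
(* Dividing by [N.+1] covers dimension zero. *)
have e1 : 0 < e / N.+1%:R by rewrite divr_gt0.
move/cvgrPdist_le: yl => /(_ _ e1); apply: filterS => k ky.
apply: le_trans (norm2_le_mx_norm _) _; rewrite distrC.
apply: (@le_trans _ _ (N.+1%:R * (e / N.+1%:R))).
  by apply: ler_pM => //; rewrite ler_nat.
by rewrite mulrC divfK// pnatr_eq0.
Qed.

Lemma lipschitz_iterates_limit_fixpoint (R : realType) N
    (T : 'cV[R]_N -> 'cV[R]_N) (C : R) (y : nat -> 'cV[R]_N) (l : 'cV[R]_N) :
    0 <= C -> (forall u v, norm2 (T u - T v) <= C * norm2 (u - v)) ->
    (forall k, y k.+1 = T (y k)) -> y k @[k --> \oo] --> l ->
  T l = l.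
Proof.
move=> C0 TC yS yl; apply/eqP; rewrite -subr_eq0 -norm2_eq0 eq_le norm2_ge0 andbT.
apply/ler_addgt0Pr => e e0; rewrite add0r.
have C1 : 0 < C + 1 by rewrite ltr_wpDl.
(* The tolerance [e / (C + 1)] splits [e] between [y k.+1 - l] and [T (y k) - T l], the latter
   costing a factor [C]. *)
have [k _ yk] := norm2_cvg0 yl (divr_gt0 e0 C1).
have -> : T l - l = (y k.+1 - l) - (T (y k) - T l).
  by rewrite yS opprB [RHS]addrC addrA subrK.
apply: le_trans (norm2B _ _) _.
have -> : e = e / (C + 1) + C * (e / (C + 1)) by field; rewrite gt_eqF.
apply: lerD; first exact/yk/leqnSn.
by apply: le_trans (TC _ _) _; rewrite ler_wpM2l//; exact/yk/leqnn.
Qed.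

Lemma norm2_limit_le (R : realType) N (y : nat -> 'cV[R]_N) (l : 'cV[R]_N) (B : R) :
  (forall k, norm2 (y k.+1) <= B) -> y k @[k --> \oo] --> l -> norm2 l <= B.
Proof.
move=> yB yl; apply/ler_addgt0Pr => e e0.
have [k _ yk] := norm2_cvg0 yl e0.
have -> : l = y k.+1 - (y k.+1 - l) by rewrite opprB addrC subrK.
by apply: le_trans (norm2B _ _) _; apply: lerD => //; exact/yk/leqnSn.
Qed.

(** * NEAR-DGD iterates: uniform bound and limit equation *)

Section NearDGD.
Context {R : realType} {n p : nat} (f : 'I_n -> 'cV[R]_p -> R) (W : 'M[R]_n).
Context (L alpha : R).
Hypotheses (fdiff : forall i x, differentiable (f i) x)
  (Wsym : W^T = W) (Wds : doubly_stochastic W) (Wpd : positive_definite W)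
  (L_gt0 : 0 < L)
  (gradLip : forall x y : 'cV[R]_(n * p),
     norm2 (grad (stacked_obj f) x - grad (stacked_obj f) y)
       <= L * norm2 (x - y))
  (fcoer : coercive (@stacked_obj R n p f))
  (alpha_gt0 : 0 < alpha) (alpha_lt : alpha < 2 / L).

Let Zt t : 'M[R]_(n * p) := kronI p W ^+ t.

Lemma trmx_exp_kronI t : (Zt t)^T = Zt t.
Proof. exact/trmx_exp/trmx_kronI. Qed.

Lemma kronI_dot_ge0 (u : 'cV[R]_(n * p)) : 0 <= dot u (kronI p W *m u).
Proof.
rewrite dot_slice; apply: sumr_ge0 => j _; rewrite slice_kronI.
have [->|u0] := eqVneq (coord_slice j u) 0; first by rewrite dot0l.
by rewrite ltW// Wpd.
Qed.

Lemma kronI_dot_le (u : 'cV[R]_(n * p)) : dot u (kronI p W *m u) <= dot u u.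
Proof.
rewrite !dot_slice; apply: ler_sum => j _.
by rewrite slice_kronI ds_dot_mulmx_le.
Qed.

Lemma norm2_exp_kronI_le t (u : 'cV[R]_(n * p)) : norm2 (Zt t *m u) <= norm2 u.
Proof.
rewrite -[leRHS]mul1r -(expr1n _ t); apply: norm2_exp_mulmx_le => // v.
apply: norm2_mulmx_le => // [|w|w]; first exact: trmx_kronI.
  exact: kronI_dot_ge0.
by rewrite mul1r kronI_dot_le.
Qed.

Lemma exp_kronI_dot_le t (u : 'cV[R]_(n * p)) : dot u (Zt t *m u) <= dot u u.
Proof.
rewrite (le_trans (dot_le_norm2 _ _))// -norm2_sqr expr2.
by rewrite ler_wpM2l ?norm2_ge0// norm2_exp_kronI_le.
Qed.

Lemma exp_kronI_dot_ge0 t (u : 'cV[R]_(n * p)) : 0 <= dot u (Zt t *m u).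
Proof.
apply: dot_exp_mulmx_ge0; [exact: trmx_kronI|exact: kronI_dot_ge0].
Qed.

Lemma neardgd_energy_le t y0 k :
  energy (stacked_obj f) alpha (Zt t) (neardgd_y f W alpha t y0 k) <=
  energy (stacked_obj f) alpha (Zt t) y0.
Proof.
elim: k => [//|k IH]; apply: le_trans IH => /=.
apply: energy_step alpha_lt _ _ _ _ => //.
- exact: is_derive_stacked_obj_line.
- exact: trmx_exp_kronI.
- exact: exp_kronI_dot_ge0.
- exact: exp_kronI_dot_le.
Qed.

Lemma neardgd_bounded y0 : exists2 B, 0 < B &
  forall t k, norm2 (neardgd_y f W alpha t y0 k.+1) <= B.
Proof.
pose h := @stacked_obj R n p f.
(* The bound of [energy_le] at [y0]; every [x_k] lies in the sublevel set of [M], whatever [t]. *)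
pose M := h 0 + norm2 (grad h 0) * norm2 y0
  + (L / 2 + (2 * alpha)^-1) * norm2 y0 ^+ 2.
have [B B0 xB] := coercive_sublevel_bounded M fcoer.
(* From [|y_(k+1)| <= |x| + alpha |grad h x|] and [|grad h x| <= |grad h 0| + L B]; the final 1
   ensures strict positivity. *)
exists (B + alpha * (norm2 (grad h 0) + L * B) + 1).
  apply: ltr_wpDl => //; apply: addr_ge0 => //.
  by rewrite mulr_ge0 ?(ltW alpha_gt0)// addr_ge0 ?norm2_ge0// mulr_ge0 ?(ltW L_gt0).
move=> t k /=; set x := Zt t *m neardgd_y f W alpha t y0 k.
have hline := is_derive_stacked_obj_line fdiff.
have xleB : norm2 x <= B.
  apply: xB; rewrite -/h.
  apply: (le_trans (energy_ge _ alpha_gt0 (trmx_exp_kronI t)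
    (exp_kronI_dot_ge0 t) (exp_kronI_dot_le t) _)).
  apply: le_trans (neardgd_energy_le t y0 k) _.
  apply: energy_le => //; first exact: trmx_exp_kronI.
    exact: exp_kronI_dot_ge0.
  exact: exp_kronI_dot_le.
apply: le_trans (norm2B _ _) _; rewrite norm2Z ?(ltW alpha_gt0)//.
rewrite -[leLHS]addr0 lerD// lerD// ler_wpM2l ?(ltW alpha_gt0)//.
rewrite -[grad _ x](subrK (grad h 0)) addrC (le_trans (norm2D _ _))// lerD2l.
by rewrite (le_trans (gradLip _ _))// subr0 ler_wpM2l ?(ltW L_gt0).
Qed.

Lemma block_mean_exp_kronI t (y : 'cV[R]_(n * p)) :
  block_mean (Zt t *m y) = block_mean y.
Proof.
apply/matrixP => j k; rewrite ord1 !block_mean_slice slice_exp_kronI.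
exact: mean_exp_mulmx.
Qed.

Lemma neardgd_limit_fixpoint t y0 (l : 'cV[R]_(n * p)) :
    neardgd_y f W alpha t y0 k @[k --> \oo] --> l ->
  Zt t *m l - alpha *: grad (stacked_obj f) (Zt t *m l) = l.
Proof.
pose T y := Zt t *m y - alpha *: grad (stacked_obj f) (Zt t *m y).
apply: (@lipschitz_iterates_limit_fixpoint _ _ T (1 + alpha * L)) => //.
  by rewrite addr_ge0// mulr_ge0 ?(ltW alpha_gt0) ?(ltW L_gt0).
move=> u v.
have -> : T u - T v = Zt t *m (u - v) - alpha *:
    (grad (stacked_obj f) (Zt t *m u) - grad (stacked_obj f) (Zt t *m v)).
  rewrite /T mulmxBr scalerBr !opprB [LHS]addrACA [RHS]addrACA.
  by congr (_ + _); rewrite addrC.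
apply: le_trans (norm2B _ _) _; rewrite norm2Z ?(ltW alpha_gt0)// mulrDl mul1r.
apply: lerD; first exact: norm2_exp_kronI_le.
rewrite -mulrA ler_wpM2l ?(ltW alpha_gt0)// (le_trans (gradLip _ _))//.
by rewrite -mulmxBr ler_wpM2l ?(ltW L_gt0)// norm2_exp_kronI_le.
Qed.

(* [Zt t] preserves block means, so the block mean of the fixpoint equation
   leaves only the gradient term. *)
Lemma sum_blk_grad_fixpoint t (l : 'cV[R]_(n * p)) : (0 < n)%N ->
    Zt t *m l - alpha *: grad (stacked_obj f) (Zt t *m l) = l ->
  \sum_i blk (grad (stacked_obj f) (Zt t *m l)) i = 0.
Proof.
move=> n0 lfix; have nV : n%:R^-1 != 0 :> R by rewrite invr_eq0 pnatr_eq0 -lt0n.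
have : block_mean (Zt t *m l - alpha *: grad (stacked_obj f) (Zt t *m l)) =
    block_mean (Zt t *m l) by rewrite lfix block_mean_exp_kronI.
move/(scalerI nV); under eq_bigr do rewrite blkB blkZ.
rewrite sumrB => /eqP; rewrite subr_eq -[X in X == _]addr0 (inj_eq (addrI _)).
by rewrite -scaler_sumr eq_sym scaler_eq0 gt_eqF//= => /eqP.
Qed.

End NearDGD.

(** * Gradient at the consensus point and conclusion *)

Lemma norm2_grad_sum_obj_le (R : realType) n p (f : 'I_n -> 'cV[R]_p -> R)
    (L : R) (x : 'cV[R]_(n * p)) (c : 'cV[R]_p) :
    (forall i y, differentiable (f i) y) ->
    (forall x y : 'cV[R]_(n * p),
       norm2 (grad (stacked_obj f) x - grad (stacked_obj f) y)
         <= L * norm2 (x - y)) ->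
    \sum_i blk (grad (stacked_obj f) x) i = 0 ->
  norm2 (grad (sum_obj f) c) <= Num.sqrt n%:R * (L * norm2 (x - stack c)).
Proof.
move=> fdiff gradLip sum0.
have -> : grad (sum_obj f) c =
    - \sum_i blk (grad (stacked_obj f) x - grad (stacked_obj f) (stack c)) i.
  under eq_bigr do rewrite blkB.
  rewrite sumrB sum0 sub0r opprK grad_sum_obj//.
  by apply: eq_bigr => i _; rewrite blk_grad_stacked_obj blk_stack.
rewrite norm2N (le_trans (norm2_sum_blk _))//.
by rewrite ler_wpM2l ?sqrtr_ge0.
Qed.

(** Z^t acts as W^t on each coordinate slice, so the squared spectral bounds of the slices add
    up. *)
Lemma norm2_consensus_error_le (R : realType) n p (W : 'M[R]_n.+1)
    (E : rel 'I_n.+1) (beta : R) t (y : 'cV[R]_(n.+1 * p)) :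
    W^T = W -> doubly_stochastic W -> positive_definite W ->
    (forall i j, connect E i j) -> (forall i j, E i j -> 0 < W i j) ->
    second_largest_eigenvalue W beta -> (0 < t)%N ->
  norm2 (kronI p W ^+ t *m y - stack (block_mean y)) <= beta ^+ t * norm2 y.
Proof.
move=> Wsym Wds Wpd Econn Wpos hbeta t0.
have beta0 : 0 <= beta ^+ t.
  by rewrite exprn_ge0// ltW// (second_eigenvalue_gt0 Wsym Wpd hbeta).
rewrite norm2_le ?mulr_ge0 ?norm2_ge0// exprMn norm2_sqr !dot_slice mulr_sumr.
apply: ler_sum => j _.
rewrite coord_sliceB slice_exp_kronI slice_stack block_mean_slice.
rewrite -norm2_sqr -(norm2_sqr (coord_slice j y)) -exprMn ler_sqr ?nnegrE ?norm2_ge0//.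
  exact: (norm2_exp_mulmx_sub_mean Wsym Wds Wpd Econn Wpos hbeta).
by rewrite mulr_ge0 ?norm2_ge0.
Qed.

Theorem mainTheorem2 (R : realType) (n p : nat) (hn : (2 <= n)%N)
    (hp : (1 <= p)%N)
    (E : rel 'I_n) (Esym : symmetric E) (Econn : forall i j, connect E i j)
    (f : 'I_n -> 'cV[R]_p -> R)
    (fdiff : forall i x, differentiable (f i) x)
    (W : 'M[R]_n) (Wsym : W^T = W) (Wds : doubly_stochastic W)
    (Wpd : positive_definite W)
    (Wpos : forall i j, E i j \/ i = j -> 0 < W i j)
    (Wzero : forall i j, ~ (E i j \/ i = j) -> W i j = 0)
    (beta : R) (hbeta : second_largest_eigenvalue W beta)
    (L : R) (L_gt0 : 0 < L)
    (gradLip : forall x y : 'cV[R]_(n * p),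
       norm2 (grad (stacked_obj f) x - grad (stacked_obj f) y)
         <= L * norm2 (x - y))
    (fcoer : coercive (@stacked_obj R n p f))
    (alpha : R) (alpha_gt0 : 0 < alpha) (alpha_lt : alpha < 2 / L)
    (LKL : forall t : nat, (0 < t)%N -> KL_function (Lyapunov f W alpha t))
    (y0 : 'cV[R]_(n * p)) :
  exists By : R,
    [/\ 0 < By,
        forall t k : nat, (0 < t)%N ->
          norm2 (neardgd_y f W alpha t y0 k.+1) <= By
      & forall t : nat, (0 < t)%N ->
          forall yinf : 'cV[R]_(n * p),
          neardgd_y f W alpha t y0 k @[k --> \oo] --> yinf ->
          let xinf := kronI p W ^+ t *m yinf in
          let xbar := block_mean xinf in
          xbar = block_mean yinf
          /\ norm2 (grad (sum_obj f) xbar)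
               <= beta ^+ t * Num.sqrt n%:R * L * By].
Proof.
have [By By0 yB] :=
  neardgd_bounded fdiff Wsym Wds Wpd L_gt0 gradLip fcoer alpha_gt0 alpha_lt y0.
exists By; split=> // t t0 yinf ycvg xinf xbar.
have xbarE : xbar = block_mean yinf by exact: block_mean_exp_kronI.
split=> //; have n0 : (0 < n)%N by exact: ltnW.
have sum0 := sum_blk_grad_fixpoint Wds alpha_gt0 n0
  (neardgd_limit_fixpoint Wsym Wds Wpd L_gt0 gradLip alpha_gt0 ycvg).
apply: le_trans (norm2_grad_sum_obj_le xbar fdiff gradLip sum0) _.
have -> : beta ^+ t * Num.sqrt n%:R * L * By = Num.sqrt n%:R * (L * (beta ^+ t * By)).
  by ring.
rewrite ler_wpM2l ?sqrtr_ge0// ler_wpM2l ?(ltW L_gt0)// xbarE.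
have Epos i j : E i j -> 0 < W i j by move=> Eij; apply: Wpos; left.
clear - Wsym Wds Wpd Econn Epos hbeta t0 yB ycvg n0.
(* The spectral estimates are stated in dimension [n.+1], so [n] is replaced by a successor
   throughout. *)
case: n n0 E f W y0 yinf Wsym Wds Wpd Econn Epos hbeta yB ycvg
  => // m _ E f W y0 yinf Wsym Wds Wpd Econn Epos hbeta yB ycvg.
apply: le_trans (norm2_consensus_error_le yinf Wsym Wds Wpd Econn Epos hbeta t0) _.
rewrite ler_wpM2l//.
  by rewrite exprn_ge0// ltW// (second_eigenvalue_gt0 Wsym Wpd hbeta).
by apply: norm2_limit_le ycvg => k; exact: yB.
Qed.
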